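(* For $n=4$, $n=5$ and every integer $n\geq 7$, \[ \sigma(K_4-e,n)=\begin{cases}3n-1 & \text{if } n \text{ is odd},\\ 3n-2 & \text{if } n \text{ is even}.\end{cases} \] For $n=6$: if $S$ is a $6$-term graphical sequence with $\sigma(S)\geq 16$, then either there is a realization of $S$ containing $K_4-e$ as a subgraph, or $S=(3,3,3,3,3,3)$. Consequently $\sigma(K_4-e,6)=20$.
   Context: All graphs are finite and simple. A sequence $S=(d_1,d_2,\dots,d_n)$ of non-negative integers (zero terms are allowed) is called graphical if there is a simple graph $G$ of order $n$ with vertices $v_1,\dots,v_n$ whose degree sequence $(d(v_1),\dots,d(v_n))$ is precisely $S$; such a $G$ is called a realization of $S$. Write $\sigma(S)=d_1+d_2+\cdots+d_n$. For a graph $H$, a graphical sequence $S$ is potentially $H$ graphical if there is a realization of $S$ containing $H$ as a (not necessarily induced) subgraph. For a graph $H$ and a positive integer $n$, $\sigma(H,n)$ denotes the minimum even integer $m$ such that every $n$-term graphical sequence $S$ with $\sigma(S)\geq m$ is potentially $H$ graphical. $K_4-e$ denotes the graph obtained from the complete graph $K_4$ on $4$ vertices by deleting one edge. *)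

(* Defs.v *)
From mathcomp Require Import all_boot.

Set Implicit Arguments.
Unset Strict Implicit.
Unset Printing Implicit Defensive.

Record sgraph (T : finType) := SGraph {
  adj :> rel T;
  adj_sym : symmetric adj;
  adj_irrefl : irreflexive adj }.

Definition degree (T : finType) (G : sgraph T) (x : T) : nat := #|[set y | G x y]|.

(* Subgraph up to isomorphism, not necessarily induced. *)
Definition contains (T U : finType) (G : sgraph T) (H : sgraph U) : Prop :=
  exists f : U -> T, injective f /\ forall x y, H x y -> G (f x) (f y).

(* Sequences are not assumed monotone: the i-th vertex has the i-th degree. *)
Definition realization n (S : n.-tuple nat) (G : sgraph 'I_n) : Prop :=
  forall i : 'I_n, degree G i = tnth S i.

Definition graphical n (S : n.-tuple nat) : Prop :=
  exists G : sgraph 'I_n, realization S G.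

Definition potentially (U : finType) (H : sgraph U) n (S : n.-tuple nat) : Prop :=
  exists G : sgraph 'I_n, realization S G /\ contains G H.

Definition seq_sum n (S : n.-tuple nat) : nat := \sum_(i < n) tnth S i.

Definition sigma_bound (U : finType) (H : sgraph U) (n m : nat) : Prop :=
  forall S : n.-tuple nat, graphical S -> m <= seq_sum S -> potentially H S.

(* is_sigma H n m is the assertion sigma(H, n) = m; the minimum is over even
   natural numbers, and the relation is functional in m. *)
Definition is_sigma (U : finType) (H : sgraph U) (n m : nat) : Prop :=
  [/\ ~~ odd m, sigma_bound H n m
    & forall k, ~~ odd k -> sigma_bound H n k -> m <= k].

Section Constructions.
Variable T : finType.

Fact complete_sym : symmetric [rel x y : T | x != y].
Proof. by move=> x y /=; rewrite eq_sym. Qed.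

Fact complete_irrefl : irreflexive [rel x y : T | x != y].
Proof. by move=> x /=; rewrite eqxx. Qed.

Definition complete : sgraph T := SGraph complete_sym complete_irrefl.

Variables (G : sgraph T) (u v : T).

Definition del_edge_rel : rel T :=
  [rel x y | G x y && ([set x; y] != [set u; v])].

Fact del_edge_sym : symmetric del_edge_rel.
Proof. by move=> x y; rewrite /del_edge_rel /= adj_sym setUC. Qed.

Fact del_edge_irrefl : irreflexive del_edge_rel.
Proof. by move=> x; rewrite /del_edge_rel /= adj_irrefl. Qed.

Definition del_edge : sgraph T := SGraph del_edge_sym del_edge_irrefl.

End Constructions.

Definition K4_minus_e : sgraph 'I_4 := del_edge (complete 'I_4) ord0 ord_max.

(* Main.v *)
Require Import Defs.
From mathcomp Require Import all_boot.
From mathcomp Require Import zify.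

Set Implicit Arguments.
Unset Strict Implicit.
Unset Printing Implicit Defensive.

(** The graph K4 minus an edge, here called a diamond, is two adjacent vertices
    (the hubs) with two common neighbours.

    Upper bound.  The threshold is proved by strong induction on the number n
    of vertices, starting from n <= 3, where no graph has enough edges.  If v
    has degree d and the degrees of G - v can be realized by a graph with a
    diamond, then adding v back with its old neighbours gives such a graph for
    G ([potentially_diamond_isolate]).  Deleting a vertex of minimum degree d
    costs 2d in the degree sum, and since the sum is at least dn this stays
    above the threshold for n - 1 except in two cases
    ([deletion_obstacles]), both with n even:
    - d = 2 and the sum is exactly 3n - 2.  Then a second vertex of degree two
      exists, the two can be made adjacent by degree-preserving switches
      ([diamond_or_potentially_adjacent]), and deleting both costs only 6,
      which is the difference between the thresholds for n and n - 2;
    - G is cubic.  For n >= 8, delete v and join two of its non-adjacent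
      neighbours, so that the sum drops by 4 only.  In the realization obtained
      by induction, some edge ts lies off the diamond and off the third
      neighbour c of v; replace it by the three edges from v to t, s and c
      ([cubic_step]).  For n = 4 the graph is K4, and for n = 6 this
      is the exceptional sequence.

    The exception 3^6 reappears only when one vertex is deleted from a graph on
    7 vertices; if there is no diamond yet, a single switch performed before the
    deletion avoids it ([seven_vertex_step]).

    Lower bound.  Both hubs of a diamond have degree at least 3.  In the
    windmill, triangles sharing one vertex (together with a pendant edge when n
    is even), only the centre has degree above 2, so its degree sequence, of
    sum 3n - 3 or 3n - 4, has no realization with a diamond.  For n = 6 a cubic
    graph is diamond-free by [cubic6_diamond_free]. *)

(** * Degrees *)

Section Graphs.
Variable T : finType.
Implicit Types (G H : sgraph T) (A M : {set T}).

Definition nbrs G x : {set T} := [set y | G x y].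

Definition degree_sum G : nat := \sum_x degree G x.

(** Vertices are never removed from the type: an induction on the number of
    vertices shrinks a set A outside of which all vertices are isolated.  Any
    graph with the same degrees is then supported on A as well. *)
Definition supported G A : Prop := forall x, x \notin A -> degree G x = 0.

Lemma degreeE G x : degree G x = \sum_y (G x y : nat).
Proof.
by rewrite /degree -sum1dep_card big_mkcond; apply: eq_bigr => y _; case: (G x y).
Qed.

Lemma adj_neq G x y : G x y -> x != y.
Proof. by apply: contraTneq => ->; rewrite adj_irrefl. Qed.

Lemma degree0_adj G x y : degree G x = 0 -> G x y = false.
Proof.
move=> /cards0_eq/setP/(_ y); by rewrite !inE.
Qed.

Lemma supported_adj G A x y : supported G A -> G x y -> (x \in A) && (y \in A).
Proof.
move=> sA Gxy; apply/andP; split; apply/negPn/negP => /sA /degree0_adj E.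
  by rewrite E in Gxy.
by rewrite adj_sym E in Gxy.
Qed.

Lemma eq_degree_sum G H : degree H =1 degree G -> degree_sum H = degree_sum G.
Proof. by move=> D; apply: eq_bigr. Qed.

Lemma degree_sum_supported G A :
  supported G A -> degree_sum G = \sum_(x in A) degree G x.
Proof.
move=> sA; rewrite [RHS]big_mkcond; apply: eq_bigr => x _.
by case: ifPn => // /sA.
Qed.

Lemma degree_lt G A x : supported G A -> x \in A -> degree G x <= #|A|.-1.
Proof.
move=> sA xA; rewrite (cardsD1 x A) xA /=; apply/subset_leq_card/subsetP => y.
rewrite !inE => Gxy; rewrite eq_sym (adj_neq Gxy) /=.
by case/andP: (supported_adj sA Gxy).
Qed.

Lemma degree_sum_le G A : supported G A -> degree_sum G <= #|A| * #|A|.-1.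
Proof.
move=> sA; rewrite (degree_sum_supported sA) -sum_nat_const.
by apply: leq_sum => x xA; exact: degree_lt.
Qed.

(** * Diamonds *)

Definition diamond G : Prop :=
  exists a b c d, [&& c != d, G a b, G a c, G a d, G b c & G b d].

Lemma contains_diamond G : contains G K4_minus_e <-> diamond G.
Proof.
split.
  case=> f [finj fH]; pose o k := f (inord k).
  have E x y : x < 4 -> y < 4 -> x != y -> (0 < x < 3) -> G (o x) (o y).
    move=> x4 y4 xy x12; apply: fH; rewrite /= /del_edge_rel /=.
    rewrite -val_eqE /= !inordK // xy /=; apply/eqP => /setP/(_ (inord x)).
    rewrite !inE eqxx /= -!val_eqE /= !inordK //; lia.
  exists (o 1), (o 2), (o 0), (o 3); rewrite !E // andbT.
  by rewrite /o (inj_eq finj) -val_eqE /= !inordK.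
case=> a [b [c [d /and5P[cd ab ac ad /andP[bc bd]]]]].
have t4 : uniq [tuple c; a; b; d].
  rewrite /= !inE !negb_or cd (adj_neq ab) (adj_neq ad) (adj_neq bd).
  by rewrite ![c == _]eq_sym (adj_neq ac) (adj_neq bc).
exists (tnth [tuple c; a; b; d]); split.
  exact/tuple_uniqP.
case=> [[|[|[|[|//]]]] i4] [[|[|[|[|//]]]] j4]; rewrite !(tnth_nth c) //=;
  rewrite /del_edge_rel //= => H;
  rewrite ?(adj_sym G c) ?(adj_sym G d) ?(adj_sym G b a) //.
- case/eqP: H.
  by apply/setP => z; rewrite !inE -!val_eqE.
- case/eqP: H.
  by apply/setP => z; rewrite !inE -!val_eqE orbC.
Qed.

Definition potentially_diamond G : Prop :=
  exists G', degree G' =1 degree G /\ diamond G'.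

Lemma diamond_potentially G : diamond G -> potentially_diamond G.
Proof. by exists G. Qed.

Lemma potentially_diamond_eq G H :
  degree H =1 degree G -> potentially_diamond H -> potentially_diamond G.
Proof. by move=> E [G' [D ?]]; exists G'; split => // x; rewrite D. Qed.

Lemma diamond_of_common G u v :
  G u v -> 1 < #|nbrs G u :&: nbrs G v| -> diamond G.
Proof.
move=> uv /card_gt1P[c [d [+ + cd]]]; rewrite !inE => /andP[uc vc] /andP[ud vd].
by exists u, v, c, d; apply/and5P; split => //; apply/andP.
Qed.

(** * Local modifications of a graph *)

Definition same_pair (u v x y : T) : bool :=
  (x == u) && (y == v) || (x == v) && (y == u).

Lemma same_pair_notin x u v y : x != u -> x != v -> same_pair u v x y = false.
Proof. by rewrite /same_pair => /negPf -> /negPf ->. Qed.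

Section Toggle.
Variables (G : sgraph T) (u v : T).

Definition toggle_rel : rel T :=
  [rel x y | (x != y) && (G x y (+) same_pair u v x y)].

Fact toggle_sym : symmetric toggle_rel.
Proof.
move=> x y; rewrite /toggle_rel /same_pair /= adj_sym eq_sym; congr (_ && (_ (+) _)).
by rewrite orbC ![(y == _) && _]andbC.
Qed.

Fact toggle_irrefl : irreflexive toggle_rel.
Proof. by move=> x; rewrite /toggle_rel /= eqxx. Qed.

Definition toggle : sgraph T := SGraph toggle_sym toggle_irrefl.

Lemma toggleE x y : toggle x y = (x != y) && (G x y (+) same_pair u v x y).
Proof. by []. Qed.

(** The equation is additive on both sides, to avoid a truncated subtraction when
    uv is an edge. *)
Lemma degree_toggle x : u != v ->
  degree toggle x + G u v * ((x == u) + (x == v)) =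
  degree G x + (~~ G u v) * ((x == u) + (x == v)).
Proof.
move=> uv.
have main1 w z : w != z -> same_pair u v w =1 pred1 z ->
    degree toggle w + G w z = degree G w + ~~ G w z.
  move=> wz E; rewrite !degreeE (bigD1 z) // [in RHS](bigD1 z) //.
  rewrite toggleE wz E [pred1 z z]/= eqxx; rewrite (eq_bigr (fun y => G w y : nat)).
    by case: (G w z) => /=; lia.
  move=> y yz; rewrite toggleE E [pred1 z y]/= (negPf yz) addbF.
  by case: eqP => [->|//]; rewrite adj_irrefl.
have [->|xu] := eqVneq x u.
  rewrite (negPf uv) !muln1 main1 // => y /=.
  by rewrite /same_pair eqxx (negPf uv) orbF.
have [->|xv] := eqVneq x v.
  rewrite !muln1 (adj_sym G u) main1 // 1?eq_sym // => y /=.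
  by rewrite /same_pair eqxx eq_sym (negPf uv).
rewrite !muln0 !addn0 !degreeE; apply: eq_bigr => y _.
rewrite toggleE /same_pair (negPf xu) (negPf xv) addbF.
by case: eqP => // ->; rewrite adj_irrefl.
Qed.

End Toggle.

Lemma degree_toggle_add G u v x : u != v -> ~~ G u v ->
  degree (toggle G u v) x = degree G x + ((x == u) + (x == v)).
Proof. by move=> uv /negPf E; have := degree_toggle G x uv; rewrite E; lia. Qed.

Lemma degree_toggle_del G u v x : G u v ->
  degree (toggle G u v) x + ((x == u) + (x == v)) = degree G x.
Proof. by move=> E; have := degree_toggle G x (adj_neq E); rewrite E; lia. Qed.

(** The edges ab and cd are replaced by ac and bd. *)
Definition switch G a b c d : sgraph T :=
  toggle (toggle (toggle (toggle G a b) c d) a c) b d.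

Section Switch.
Variables (G : sgraph T) (a b c d : T).
Hypotheses (ab : G a b) (cd : G c d) (ac : ~~ G a c) (bd : ~~ G b d).
Hypotheses (neq_ac : a != c) (neq_bd : b != d).

Lemma switch_adj x y : switch G a b c d x y = (x != y) &&
  (G x y (+) same_pair a b x y (+) same_pair c d x y
         (+) same_pair a c x y (+) same_pair b d x y).
Proof. by rewrite !toggleE; case: (x == y). Qed.

Let neq_ad : a != d.
Proof. by apply: contraNneq ac => ->; rewrite adj_sym. Qed.
Let neq_bc : b != c.
Proof. by apply: contraNneq bd => ->. Qed.

Lemma degree_switch : degree (switch G a b c d) =1 degree G.
Proof.
have neqab := adj_neq ab; have neqcd := adj_neq cd.
have E := (negPf neq_ad, negPf neq_bc, negPf neq_ac, negPf neq_bd, negPf neqab,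
  negPf neqcd).
have F (u v : T) : u != v -> (v == u) = false by rewrite eq_sym => /negPf.
have E' := (F _ _ neq_ad, F _ _ neq_bc, F _ _ neq_ac, F _ _ neq_bd, F _ _ neqab,
  F _ _ neqcd).
move=> x; rewrite /switch degree_toggle_add //; last first.
  by rewrite !toggleE /same_pair !eqxx ?E ?E' /= ?andbF /= (negPf bd).
rewrite degree_toggle_add //; last first.
  by rewrite !toggleE /same_pair !eqxx ?E ?E' /= ?andbF /= (negPf ac).
rewrite -(degree_toggle_del x ab) -(@degree_toggle_del (toggle G a b) c d x).
  clear; lia.
by rewrite !toggleE /same_pair ?E ?E' /= cd.
Qed.

End Switch.

Section Isolate.
Variables (G : sgraph T) (v : T).

Definition isolate_rel : rel T := [rel x y | [&& x != v, y != v & G x y]].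

Fact isolate_sym : symmetric isolate_rel.
Proof. by move=> x y; rewrite /isolate_rel /= adj_sym andbCA. Qed.

Fact isolate_irrefl : irreflexive isolate_rel.
Proof. by move=> x; rewrite /isolate_rel /= adj_irrefl !andbF. Qed.

Definition isolate : sgraph T := SGraph isolate_sym isolate_irrefl.

Lemma isolateE x y : isolate x y = [&& x != v, y != v & G x y].
Proof. by []. Qed.

Lemma degree_isolate_self : degree isolate v = 0.
Proof. by rewrite degreeE big1 // => y _; rewrite isolateE eqxx. Qed.

Lemma degree_isolate x : x != v -> degree isolate x + G v x = degree G x.
Proof.
move=> xv; rewrite !degreeE (bigD1 v) // [in RHS](bigD1 v) // isolateE eqxx /= andbF add0n.
rewrite addnC adj_sym; congr (_ + _); apply: eq_bigr => y yv.
by rewrite /isolate_rel /= xv yv.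
Qed.

Lemma degree_sum_isolate : degree_sum isolate + (degree G v).*2 = degree_sum G.
Proof.
rewrite /degree_sum (bigD1 v) //= [in RHS](bigD1 v) //= degree_isolate_self add0n.
have -> : \sum_(x | x != v) degree G x =
          \sum_(x | x != v) (degree isolate x + G v x).
  by apply: eq_bigr => x xv; rewrite degree_isolate.
rewrite big_split /= -addnn.
have -> : degree G v = \sum_(x | x != v) (G v x : nat).
  by rewrite degreeE (bigD1 v) //= adj_irrefl.
by rewrite addnA addnC.
Qed.

Lemma supported_isolate A : supported G A -> supported isolate (A :\ v).
Proof.
move=> sA x; rewrite !inE negb_and negbK => /orP[/eqP->|xA].
  exact: degree_isolate_self.
have [->|xv] := eqVneq x v; first exact: degree_isolate_self.
by have := degree_isolate xv; rewrite sA //; clear; lia.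
Qed.


End Isolate.
Arguments supported_isolate [G] v [A].

Section Attach.
Variables (G : sgraph T) (v : T) (M : {set T}).

Definition attach_rel : rel T :=
  [rel x y | (x != y) && [|| G x y, (x == v) && (y \in M) | (y == v) && (x \in M)]].

Fact attach_sym : symmetric attach_rel.
Proof.
move=> x y; rewrite /attach_rel /= adj_sym eq_sym; congr (_ && (_ || _)).
by rewrite orbC.
Qed.

Fact attach_irrefl : irreflexive attach_rel.
Proof. by move=> x; rewrite /attach_rel /= eqxx. Qed.

Definition attach : sgraph T := SGraph attach_sym attach_irrefl.

Lemma attachE x y : attach x y =
  (x != y) && [|| G x y, (x == v) && (y \in M) | (y == v) && (x \in M)].
Proof. by []. Qed.

Lemma diamond_attach : diamond G -> diamond attach.
Proof.
have E x y : G x y -> attach x y by move=> xy; rewrite attachE (adj_neq xy) xy.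
case=> a [b [c [d /and5P[cd ab ac ad /andP[bc bd]]]]].
by exists a, b, c, d; rewrite cd !E.
Qed.

Hypotheses (v0 : degree G v = 0) (vM : v \notin M).

Lemma degree_attach x :
  degree attach x = if x == v then #|M| else degree G x + (x \in M).
Proof.
have [->|xv] := eqVneq x v.
  congr #|pred_of_set _|; apply/setP => y; rewrite !inE attachE eqxx degree0_adj //=.
  case: eqP => [<-|_] /=; first by rewrite (negPf vM).
  by rewrite (negPf vM) andbF orbF.
rewrite !degreeE (bigD1 v) // [in RHS](bigD1 v) // attachE eqxx xv.
have -> : G x v = false by rewrite adj_sym degree0_adj.
rewrite (negPf xv) /= add0n addnC; congr (_ + _); apply: eq_bigr => y /negPf yv.
rewrite /attach_rel /= yv (negPf xv) orbF; case: eqP => // ->; by rewrite adj_irrefl.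
Qed.

End Attach.

(** Attaching v to its old neighbours restores all degrees, whatever realization
    of the remaining degrees is used. *)
Lemma potentially_diamond_isolate G v :
  potentially_diamond (isolate G v) -> potentially_diamond G.
Proof.
case=> G' [E D]; exists (attach G' v (nbrs G v)); split; last exact: diamond_attach.
have v0 : degree G' v = 0 by rewrite E degree_isolate_self.
move=> x; rewrite degree_attach //; last by rewrite inE adj_irrefl.
by case: eqVneq => [->//|xv]; rewrite E inE degree_isolate.
Qed.

(** The handshake lemma, by removing the vertices one at a time. *)
Lemma degree_sum_even G : ~~ odd (degree_sum G).
Proof.
have [n] := ubnP #|[set: T]|; have : supported G [set: T] by move=> x; rewrite inE.
elim: n G [set: T] => // n IH G A sA An.
have [A0|[v vA]] := set_0Vmem A.
  by rewrite (degree_sum_supported sA) A0 big_set0.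
rewrite -(degree_sum_isolate G v) oddD odd_double addbF.
by apply: (IH _ _ (supported_isolate v sA)); move: An; rewrite (cardsD1 v) vA.
Qed.

(** * Making two vertices of degree two adjacent *)

Definition potentially_adjacent G u v : Prop :=
  exists G', degree G' =1 degree G /\ G' u v.

Lemma switch_join G u v a b : u != v -> a != b ->
  G u a -> G v b -> ~~ G u v -> ~~ G a b -> potentially_adjacent G u v.
Proof.
move=> uv ab ua vb nuv nab; exists (switch G u a v b).
split; first exact: degree_switch.
have au : u != a := adj_neq ua; have bv : v != b := adj_neq vb.
have ub : (u == b) = false by apply: contraNF nuv => /eqP ->; rewrite adj_sym.
rewrite switch_adj uv (negPf nuv) /same_pair !eqxx ub (negPf uv) (negPf au) (eq_sym v a).
have -> : (a == v) = false by apply: contraNF nuv => /eqP <-.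
by [].
Qed.

(** If v has a neighbour b other than a1 and a2, then a1 and a2 are hubs with
    common neighbours u and b; otherwise u and v are both joined to a1 and a2. *)
Lemma diamond_complete_nbrs G u v a1 a2 : u != v -> ~~ G u v -> 1 < degree G v ->
  G u a1 -> G u a2 -> G a1 a2 ->
  (forall a b, G u a -> G v b -> a != b -> G a b) -> diamond G.
Proof.
move=> uv nuv /card_gt1P[b1 [b2 [+ + b12]]] ua1 ua2 a12 full.
rewrite !inE => vb1 vb2.
have out b : G v b -> ~~ ((b == a1) || (b == a2)) -> diamond G.
  rewrite negb_or => vb /andP[b1' b2']; exists a1, a2, u, b.
  have ub : u != b by apply: contraNneq nuv => ->; rewrite adj_sym.
  have a1b : G a1 b by apply: full; rewrite // eq_sym.
  have a2b : G a2 b by apply: full; rewrite // eq_sym.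
  by rewrite ub a12 !(adj_sym G _ u) ua1 ua2 a1b.
have [in1|/(out _ vb1)//] := boolP ((b1 == a1) || (b1 == a2)).
have [in2|/(out _ vb2)//] := boolP ((b2 == a1) || (b2 == a2)).
have [va1 va2] : G v a1 /\ G v a2.
  by case/orP: in1 in2 vb1 vb2 b12 => /eqP -> /orP[]/eqP -> //; rewrite eqxx.
by exists a1, a2, u, v; rewrite uv a12 !(adj_sym G _ u) !(adj_sym G _ v) ua1 ua2 va1.
Qed.

(** If a neighbour a of u and a neighbour b of v are distinct and non-adjacent,
    one switch replaces ua and vb by uv and ab.  Otherwise every such pair is
    adjacent, which leaves a diamond or K33 minus the edge uv. *)
Lemma diamond_or_potentially_adjacent G u v : u != v -> degree G u = 2 -> degree G v = 2 ->
  diamond G \/ potentially_adjacent G u v.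
Proof.
move=> uv du dv; have [adj|nuv] := boolP (G u v); first by right; exists G.
case: (boolP [exists a, exists b, [&& G u a, G v b, a != b & ~~ G a b]]).
  case/existsP=> a /existsP[b /and4P[ua vb ab nab]].
  by right; exact: (switch_join uv ab ua vb nuv nab).
move=> none.
have full a b : G u a -> G v b -> a != b -> G a b.
  move=> ua vb ab; apply: contraNT none => nab.
  by apply/existsP; exists a; apply/existsP; exists b; apply/and4P.
have full' a b : G v a -> G u b -> a != b -> G a b.
  by move=> va ub ab; rewrite adj_sym full // eq_sym.
have /card_gt1P[a1 [a2 [+ + a12]]] : 1 < degree G u by rewrite du.
have /card_gt1P[b1 [b2 [+ + b12]]] : 1 < degree G v by rewrite dv.
rewrite !inE => vb1 vb2 ua1 ua2.
have [ada|na] := boolP (G a1 a2).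
  left; apply: (@diamond_complete_nbrs _ u v a1 a2) => //; by rewrite dv.
have [adb|nb] := boolP (G b1 b2).
  left; apply: (@diamond_complete_nbrs _ v u b1 b2) => //.
  - by rewrite eq_sym.
  - by rewrite adj_sym.
  - by rewrite du.
(* Now the two neighbourhoods are disjoint and independent, and together with u
   and v they induce K33 minus the edge uv.  Moving the edge v b2 to v a2 gives
   u and v the non-adjacent neighbours a1 and a2. *)
have nva1 : ~~ G v a1.
  by apply: contraNN na => va1; rewrite adj_sym; apply: full => //; rewrite eq_sym.
have nva2 : ~~ G v a2 by apply: contraNN na => va2; exact: full.
have neq x b : ~~ G v x -> G v b -> x != b by move=> nvx; apply: contraTneq => <-.
have nvu : ~~ G v u by rewrite adj_sym.
have va1 : v != a1 by apply: contraNneq nuv => ->.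
have va2 : v != a2 by apply: contraNneq nuv => ->.
have a2b1 : G a2 b1 by apply: full; rewrite ?neq.
have nb' : ~~ G b2 b1 by rewrite adj_sym.
have b21 : b2 != b1 by rewrite eq_sym.
have outside x : x != v -> ~~ G v x -> x != a2 ->
    switch G v b2 a2 b1 x =1 G x.
  move=> xv nvx xa y; have [xb1 xb2] := (neq _ _ nvx vb1, neq _ _ nvx vb2).
  rewrite switch_adj !same_pair_notin // !addbF.
  by case: eqP => // <-; rewrite adj_irrefl.
apply: or_intror; have [] // := @switch_join (switch G v b2 a2 b1) u v a1 a2.
- by rewrite outside ?(adj_neq ua2).
- rewrite switch_adj va2 (negPf nva2) /same_pair !eqxx.
  rewrite (negPf (neq _ _ nva2 vb2)) (negPf va2) (negPf (adj_neq vb1)) (negPf (adj_neq vb2)).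
  by rewrite ?andbF.
- by rewrite outside ?(adj_neq ua2).
- by rewrite outside // eq_sym.
move=> G' [D E]; exists G'; split => // x; rewrite D.
exact: degree_switch.
Qed.

(** * The upper bound *)

Definition threshold n : nat :=
  if odd n then 3 * n - 1 else 3 * n - 2.

Definition all_three G A : Prop := forall x, x \in A -> degree G x = 3.

Definition dense_forces_diamond n : Prop := forall G A, #|A| = n -> supported G A ->
  threshold n <= degree_sum G -> ~ (n = 6 /\ all_three G A) ->
  potentially_diamond G.

Lemma degree_sum_const G A k : supported G A ->
  (forall x, x \in A -> degree G x = k) -> degree_sum G = #|A| * k.
Proof.
by move=> sA Ak; rewrite (degree_sum_supported sA) -sum_nat_const; apply: eq_bigr.
Qed.

(** K is the vertex set of a diamond: an edge with an end outside K is not one of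
    its edges. *)
Lemma diamond_toggle G : diamond G ->
  exists2 K : {set T}, #|K| <= 4 & forall t w, t \notin K -> diamond (toggle G t w).
Proof.
case=> a [b [c [d /and5P[cd ab ac ad /andP[bc bd]]]]].
exists [set a; b; c; d].
  do 3! (rewrite setUC cardsU1; apply: (@leq_add _ _ 1); first by case: (_ \notin _)).
  by rewrite cards1.
move=> t w; rewrite !inE !negb_or => /andP[/andP[/andP[ta tb] tc] td].
have E x y : t != x -> t != y -> G x y -> toggle G t w x y.
  move=> tx ty xy; rewrite toggleE (adj_neq xy) xy /same_pair.
  by rewrite ![_ == t]eq_sym (negPf tx) (negPf ty) /= andbF.
by exists a, b, c, d; rewrite cd !E.
Qed.

(** The edge ab compensates the loss of v at a and b, so that only c has a smaller
    degree and the degree sum is 3(n - 1) - 1, enough for the induction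
    hypothesis.  In the realization that it gives, v is reinserted on an edge tw
    and attached to c.  As n >= 8, some vertex t of A - v is neither c nor on the
    diamond; it has degree 3, hence a neighbour w other than c. *)
Lemma cubic_step G A v a b c : 7 < #|A| -> dense_forces_diamond #|A|.-1 ->
  supported G A -> all_three G A -> v \in A ->
  nbrs G v = [set a; b; c] -> a != b -> a != c -> b != c -> ~~ G a b ->
  potentially_diamond G.
Proof.
move=> A8 IH sA A3 vA Nv ab ac bc nab.
have vE x : G v x = (x == a) || (x == b) || (x == c).
  by have /setP/(_ x) := Nv; rewrite !inE.
have [va vb vc] : [/\ G v a, G v b & G v c] by rewrite !vE !eqxx !orbT.
pose G1 := toggle (isolate G v) a b.
have cA : c \in A by case/andP: (supported_adj sA vc).
have D1 x : x != v -> degree G1 x + (x == c) = degree G x.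
  move=> xv; rewrite degree_toggle_add //; last by rewrite isolateE (negPf nab) !andbF.
  rewrite -(degree_isolate G xv) vE.
  have [->|_] := eqVneq x a; first by rewrite (negPf ab) (negPf ac); clear; lia.
  have [->|_] := eqVneq x b; first by rewrite (negPf bc); clear; lia.
  by case: (x == c); clear; lia.
have D1v : degree G1 v = 0.
  rewrite degree_toggle_add //; last by rewrite isolateE (negPf nab) !andbF.
  by rewrite degree_isolate_self (negPf (adj_neq va)) (negPf (adj_neq vb)).
have sA1 : supported G1 (A :\ v).
  move=> x; rewrite !inE negb_and negbK => /orP[/eqP-> //|xA].
  have [->//|xv] := eqVneq x v.
  by have := D1 x xv; rewrite sA //; clear; lia.
have cAv : #|A :\ v| = #|A|.-1 by rewrite (cardsD1 v A) vA.
have sum1 : degree_sum G1 + 1 = #|A|.-1 * 3.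
  rewrite (degree_sum_supported sA1) -cAv -sum_nat_const.
  have e1 : \sum_(x in A :\ v) (x == c) = 1.
    have cv : c \in A :\ v by rewrite !inE cA eq_sym (adj_neq vc).
    rewrite (bigD1 c) //= eqxx big1 // => x /andP[_ /negPf -> //].
  rewrite -[X in _ + X = _]e1 -big_split /=; apply: eq_bigr => x; rewrite !inE => /andP[xv xA].
  by rewrite D1 // A3.
have [||G2 [D2 /diamond_toggle[K K4 Ktog]]] := IH G1 _ cAv sA1.
- by move: A8 sum1; rewrite /threshold; case: ifP => _; clear; lia.
- by case=> e _; clear -A8 e; lia.
have /set0Pn[t] : (A :\ v) :\: (c |: K) != set0.
  rewrite setD_eq0; apply/negP => /subset_leq_card.
  by rewrite cAv cardsU1; move: K4 A8; case: (c \notin K); clear; lia.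
rewrite !inE negb_or => /and3P[/andP[tc tK] tv tA].
have t3 : degree G2 t = 3.
  by have := D1 t tv; rewrite (negPf tc) A3 // D2 addn0.
have /card_gt0P[w] : 0 < #|nbrs G2 t :\ c|.
  have := cardsD1 c (nbrs G2 t); rewrite (t3 : #|nbrs G2 t| = 3).
  by case: (c \in _); clear; lia.
rewrite !inE => /andP[wc tw].
have D2v : degree G2 v = 0 by rewrite D2.
have wv : w != v.
  by apply: contraTneq tw => ->; rewrite adj_sym degree0_adj.
have cv : c != v by rewrite eq_sym (adj_neq vc).
pose M := [set t; w; c].
have vM : v \notin M by rewrite !inE ![v == _]eq_sym (negPf tv) (negPf wv) (negPf cv).
have D3v : degree (toggle G2 t w) v = 0.
  by have := degree_toggle_del v tw; rewrite D2v; clear; lia.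
exists (attach (toggle G2 t w) v M); split; last first.
  exact/diamond_attach/Ktog.
have twn := adj_neq tw.
move=> x; rewrite degree_attach //; case: eqVneq => [->|xv].
  by rewrite A3 // /M setUC cardsU1 cards2 !inE twn negb_or ![c == _]eq_sym tc wc.
have := degree_toggle_del x tw; rewrite D2 -(D1 x xv) !inE.
have [->|_] := eqVneq x t; first by rewrite (negPf twn) (negPf tc) /=; clear; lia.
have [->|_] := eqVneq x w; first by rewrite (negPf wc) /=; clear; lia.
by case: (x == c) => /=; clear; lia.
Qed.

(** Among the three neighbours of a vertex, either two are non-adjacent and
    [cubic_step] applies, or they form with it a K4.  On four vertices a cubic
    graph is K4 itself. *)
Lemma cubic_potentially_diamond G A : 3 < #|A| -> #|A| <> 6 -> dense_forces_diamond #|A|.-1 ->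
  supported G A -> all_three G A -> potentially_diamond G.
Proof.
move=> A4 A6 IH sA A3.
have /card_gt0P[v vA] : 0 < #|A| by clear -A4; lia.
have := degree_sum_even G; rewrite (degree_sum_const sA A3) oddM andbT => Aodd.
have v3 : degree G v = 3 by exact: A3.
have /card_gt2P[a [b [c [[va vb vc] [ab bc ca]]]]] : 2 < #|nbrs G v| by rewrite -/(degree G v) v3.
have nonadj x y z : x \in nbrs G v -> y \in nbrs G v -> z \in nbrs G v ->
    x != y -> y != z -> z != x -> ~~ G x y -> potentially_diamond G.
  move=> vx vy vz xy yz zx nxy; have [A8|A8] := ltnP 7 #|A|.
    apply: (@cubic_step G A v x y z) => //; last by rewrite eq_sym.
    apply/eqP; rewrite eq_sym setUC eqEcard; apply/andP; split.
      by apply/subsetP => t; rewrite in_setU1 in_set2 => /orP[|/orP[]] /eqP ->.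
    by rewrite -/(degree G v) v3 cardsU1 cards2 !inE negb_or zx (eq_sym z) yz xy.
  have A4' : #|A| = 4 by move: Aodd A6 A4 A8; clear; case: #|A| => [|[|[|[|[|[|[|[|[|]]]]]]]]].
  have xA : x \in A.
    by move: vx; rewrite inE => vx; case/andP: (supported_adj sA vx).
  have yA : y \in A.
    by move: vy; rewrite inE => vy; case/andP: (supported_adj sA vy).
  have /eqP/setP/(_ y) : nbrs G x == A :\ x.
    rewrite eqEcard -/(degree G x) A3 //; have := cardsD1 x A; rewrite xA A4' => -[]; rewrite add0n => <-.
    rewrite andbT; apply/subsetP => t; rewrite !inE => xt; rewrite eq_sym (adj_neq xt).
    by case/andP: (supported_adj sA xt).
  by rewrite !inE (negPf nxy) eq_sym xy yA.
have [xab|] := boolP (G a b); last exact: (nonadj a b c).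
have [xac|] := boolP (G a c); last first.
  by apply: (nonadj a c b) => //; rewrite eq_sym.
apply: diamond_potentially; exists v, a, b, c.
by move: va vb vc; rewrite !inE bc xab xac => -> -> ->.
Qed.

(** A switch replacing vw and yz by vy and wz, with w adjacent to v and y not,
    leaves w with degree 4 after the deletion of v, so that the exception on six
    vertices is avoided.  If no such switch exists for w, every vertex y outside
    the neighbourhood of v has all its neighbours, except possibly w, among those
    of w.  Either some y is adjacent to w, and w and y are hubs of a diamond, or
    the at least three vertices y have the same three neighbours as w in G - v,
    and each of these neighbours then has degree at least 4 in G - v. *)
Lemma seven_vertex_step G A v : #|A| = 7 -> dense_forces_diamond 6 ->
  supported G A -> v \in A -> 0 < degree G v <= 3 ->
  all_three (isolate G v) (A :\ v) -> potentially_diamond G.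
Proof.
move=> A7 IH sA vA /andP[v0 v3] A3.
have /card_gt0P[w] := v0; rewrite inE => vw.
have wA : w \in A by case/andP: (supported_adj sA vw).
have A6 : #|A :\ v| = 6 by move: A7; rewrite (cardsD1 v A) vA; clear; lia.
have wv : w != v by rewrite eq_sym (adj_neq vw).
case: (boolP [exists y in A :\ v, exists z,
         [&& ~~ G v y, G y z, ~~ G w z & w != z]]).
  case/existsP=> y /andP[yA /existsP[z /and4P[nvy yz nwz wz]]].
  have yv : v != y by move: yA; rewrite !inE eq_sym => /andP[].
  pose G' := switch G v w y z.
  have D' : degree G' =1 degree G by exact: degree_switch.
  apply: (potentially_diamond_eq D'); apply: (@potentially_diamond_isolate _ v).
  have sA' : supported G' A by move=> x /sA; rewrite D'.
  apply: (IH _ _ A6 (supported_isolate v sA')).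
    have := degree_sum_isolate G' v; have := degree_sum_isolate G v.
    rewrite (degree_sum_const (supported_isolate v sA) A3) A6 D'.
    rewrite (eq_degree_sum D').
    by rewrite /threshold /=; clear; lia.
  case=> _ /(_ w); rewrite !inE wv wA => /(_ isT).
  have := degree_isolate G' wv; rewrite D' -(degree_isolate G wv) vw.
  rewrite A3 ?inE ?wv //.
  have -> : G' v w = false; last by clear; lia.
  rewrite /G' switch_adj vw eq_sym wv.
  have wy : w != y by apply: contraTneq vw => ->.
  have vz : v != z by apply: contraNneq nvy => ->; rewrite adj_sym.
  rewrite {1}/same_pair !eqxx /= ![same_pair _ _ v w]/same_pair !eqxx (negPf wy) (negPf wz).
  by rewrite (negPf yv) (negPf vz) !(eq_sym v) (negPf wv) !andbF.
move=> none.
pose Y := (A :\ v) :\: nbrs G v.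
have full y z : y \in Y -> G y z -> z != w -> G w z.
  rewrite inE => /andP[]; rewrite inE => nvy yA yz zw; apply: contraNT none => nwz.
  apply/existsP; exists y; rewrite yA; apply/existsP; exists z.
  by rewrite nvy yz nwz eq_sym.
have Y3 y : y \in Y -> degree G y = 3.
  rewrite !inE => /and3P[nvy yv yA].
  by rewrite -(degree_isolate G yv) A3 ?inE ?yv // (negPf nvy).
have w4 : degree G w = 4 by rewrite -(degree_isolate G wv) A3 ?inE ?wv // vw.
have cY : 2 < #|Y|.
  have := cardsID (nbrs G v) (A :\ v); rewrite -/Y A6.
  have := subset_leq_card (subsetIr (A :\ v) (nbrs G v)).
  by move: v3; rewrite /degree -/(nbrs G v); clear; lia.
case: (boolP [exists y in Y, G y w]).
  case/existsP=> y /andP[yY yw]; apply: diamond_potentially.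
  apply: (diamond_of_common yw).
  have : nbrs G y :\ w \subset nbrs G y :&: nbrs G w.
    apply/subsetP => z; rewrite !inE => /andP[zw yz]; rewrite yz.
    exact: full yY yz zw.
  move/subset_leq_card; have := Y3 y yY.
  by rewrite /degree -/(nbrs G y) (cardsD1 w) inE yw; clear; lia.
move=> nYw.
have NY y : y \in Y -> nbrs G y = nbrs G w :\ v.
  move=> yY; apply/eqP; rewrite eqEcard; apply/andP; split.
    apply/subsetP => z; rewrite !inE => yz; apply/andP; split.
      apply: contraTneq yz => ->; move: yY; rewrite !inE adj_sym.
      by case/andP.
    apply: (full y) => //; apply: contraNneq nYw => <-.
    by apply/existsP; exists y; rewrite yY.
  move: w4 (Y3 y yY); rewrite /degree -/(nbrs G w) -/(nbrs G y) (cardsD1 v (nbrs G w)).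
  by rewrite inE adj_sym vw; clear; lia.
have /card_gt0P[y yY] : 0 < #|Y| by clear -cY; lia.
have /card_gt0P[p] : 0 < degree G y by rewrite Y3.
rewrite -/(nbrs G y) NY // !inE => /andP[pv wp].
have pA : p \in A by case/andP: (supported_adj sA wp).
have := degree_isolate G pv; rewrite A3 ?inE ?pv //.
have : w |: Y \subset nbrs G p :\ v.
  apply/subsetP => x; rewrite in_setU1 => /orP[/eqP->|xY].
    by rewrite !inE wv adj_sym.
  move: (xY); rewrite !inE => /and3P[_ -> _] /=; rewrite adj_sym.
  by have /setP/(_ p) := NY _ xY; rewrite !inE pv wp.
move/subset_leq_card; rewrite cardsU1 /degree -/(nbrs G p) (cardsD1 v (nbrs G p)).
rewrite !inE vw /= (adj_sym G p); move: cY; clear; lia.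
Qed.

Lemma degree_sum_ge G A x k : supported G A -> x \in A ->
  (forall y, y \in A :\ x -> k <= degree G y) ->
  degree G x + #|A|.-1 * k <= degree_sum G.
Proof.
move=> sA xA Ak; rewrite (degree_sum_supported sA) (big_setD1 x) //= leq_add2l.
have -> : #|A|.-1 = #|A :\ x| by rewrite (cardsD1 x A) xA.
by rewrite -sum_nat_const; exact: leq_sum.
Qed.

(** Here s is the degree sum and d the minimum degree. *)
Lemma deletion_obstacles n d s : 3 < n -> n * d <= s -> threshold n <= s -> ~~ odd s ->
  s < threshold n.-1 + d.*2 ->
  ~~ odd n /\ (d = 2 /\ s = 3 * n - 2 \/ d = 3 /\ s = 3 * n).
Proof.
rewrite /threshold => n4; case: (ltnP 3 d) => [d4 nd | d3].
  have e : n * 4 + (d - 4).*2 <= n * d by clear -n4 d4; nia.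
  have {e nd} := leq_trans e nd; move: n4 d4; clear.
  by do 2! case: ifP => ?; lia.
case: d d3 => [|[|[|[|//]]]] _; do 2! case: ifP => ?; lia.
Qed.

Theorem threshold_forces_diamond n : 0 < n -> dense_forces_diamond n.
Proof.
elim/ltn_ind: n => n IH n0 G A An sA thr ex.
have [n3|n4] := leqP n 3.
  have := leq_trans thr (degree_sum_le sA); rewrite An.
  by move: n0 n3; clear; rewrite /threshold; case: n => [|[|[|[|]]]].
have [a0 a0A] : exists a0, a0 \in A by apply/card_gt0P; rewrite An; clear -n4; lia.
have [v vA vmin] : exists2 v, v \in A & forall y, y \in A -> degree G v <= degree G y.
  by case: (arg_minnP (degree G) a0A) => v; exists v.
have {a0 a0A} AvA y : y \in A :\ v -> y \in A by rewrite inE => /andP[].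
have [d dv] : exists d, degree G v = d by exists (degree G v).
have sumd : n * d <= degree_sum G.
  have := degree_sum_ge sA vA (fun y yA => vmin y (AvA y yA)).
  by rewrite dv An; case: (n) n0 => // m _; rewrite mulSn.
have cAv : #|A :\ v| = n.-1 by rewrite -An (cardsD1 v A) vA.
have even := degree_sum_even G.
have sumv := degree_sum_isolate G v; rewrite dv in sumv.
have sAv := supported_isolate v sA.
have [big|small] := leqP (threshold n.-1 + d.*2) (degree_sum G).
  have [/andP[/eqP n7 /forall_inP A3]|nex] :=
      boolP ((n == 7) && [forall x in A :\ v, degree (isolate G v) x == 3]).
    have A3' : all_three (isolate G v) (A :\ v) by move=> x /A3/eqP.
    apply: (seven_vertex_step (A := A) (v := v)) => //; first by rewrite An.
      by apply: IH; rewrite ?n7.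
    move: sumv thr sumd; rewrite (degree_sum_const sAv A3') cAv dv n7 /threshold /=.
    by clear; lia.
  apply: (@potentially_diamond_isolate _ v); apply: (IH n.-1 _ _ _ _ cAv sAv).
  - by clear -n4; lia.
  - by clear -n4; lia.
  - by move: big; rewrite -sumv leq_add2r.
  case=> n6 A3; case/negP: nex; apply/andP; split; first by apply/eqP; clear -n6; lia.
  by apply/forall_inP => x /A3 ->.
have [nodd [[d2 sum]|[d3 sum]]] := deletion_obstacles n4 sumd thr even small.
  have [u uA u2] : exists2 u, u \in A :\ v & degree G u = 2.
    have [/existsP[u /andP[uA /eqP u2]]|none] :=
      boolP [exists u in A :\ v, degree G u == 2]; first by exists u.
    have ge3 y : y \in A :\ v -> 3 <= degree G y.
      move=> yA; have := vmin _ (AvA _ yA); rewrite dv d2 leq_eqVlt => /orP[/eqP e|//].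
      by case/negP: none; apply/existsP; exists y; rewrite yA -e.
    have := degree_sum_ge sA vA ge3; rewrite sum dv An d2; move: n4; clear; lia.
  have uv : u != v by move: uA; rewrite !inE => /andP[].
  rewrite d2 in dv.
  have [/diamond_potentially //|[G' [D' Guv]]] := diamond_or_potentially_adjacent uv u2 dv.
  apply: (potentially_diamond_eq D'); apply: (@potentially_diamond_isolate _ v); apply: (@potentially_diamond_isolate _ u).
  have sA' : supported G' A by move=> x /sA; rewrite D'.
  have sA2 := supported_isolate u (supported_isolate v sA').
  have cA2 : #|A :\ v :\ u| = n - 2 by have := cardsD1 u (A :\ v); rewrite uA cAv; clear; lia.
  have sum2 : degree_sum (isolate (isolate G' v) u) + 6 = 3 * n - 2.
    rewrite -sum -(eq_degree_sum D') -(degree_sum_isolate G' v).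
    rewrite -(degree_sum_isolate (isolate G' v) u) D' dv.
    have := degree_isolate G' uv; rewrite D' u2 adj_sym Guv => e.
    have -> : degree (isolate G' v) u = 1 by clear -e; lia.
    by rewrite -addnA.
  apply: (IH (n - 2) _ _ _ _ cA2 sA2).
  - by clear -n4; lia.
  - by clear -n4; lia.
    move: sum2 n4 nodd; rewrite /threshold; clear.
    by case: ifP => ?; lia.
  case=> n6 A3; move: sum2 cA2; rewrite (degree_sum_const sA2 A3).
  by move=> + e; rewrite e; clear -n6; lia.
have A3 : all_three G A.
  have ge3 y : y \in A -> 3 <= degree G y by rewrite -d3 -dv; exact: vmin.
  move=> x xA; apply/eqP; rewrite eqn_leq ge3 // andbT.
  have : degree G x + #|A|.-1 * 3 <= degree_sum G.
    by apply: degree_sum_ge => // y; rewrite inE => /andP[_ /ge3].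
  by rewrite An sum; clear -n4; lia.
apply: (cubic_potentially_diamond (A := A)) => //; rewrite ?An //.
  by move=> n6; apply: ex.
by apply: IH; clear -n4; lia.
Qed.

End Graphs.

(** * The lower bound *)

Lemma diamond_hubs (T : finType) (G : sgraph T) : diamond G ->
  exists a b, [/\ a != b, 2 < degree G a & 2 < degree G b].
Proof.
case=> a [b [c [d /and5P[cd ab ac ad /andP[bc bd]]]]]; exists a, b.
split; first exact: adj_neq ab.
- apply/card_gt2P; exists b, c, d; rewrite !inE; split=> //.
  by rewrite (adj_neq bc) cd eq_sym (adj_neq bd).
apply/card_gt2P; exists a, c, d; rewrite !inE adj_sym; split=> //.
by rewrite (adj_neq ac) cd eq_sym (adj_neq ad).
Qed.

(** The hubs have no neighbour outside the diamond, so each of the two vertices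
    outside is joined to all vertices but the hubs and itself.  A non-hub vertex of
    the diamond is then adjacent to both hubs and to both vertices outside. *)
Lemma cubic6_diamond_free (T : finType) (G : sgraph T) : #|T| = 6 ->
  (forall x, degree G x = 3) -> ~ diamond G.
Proof.
move=> T6 G3 [a [b [c [d /and5P[cd ab ac ad /andP[bc bd]]]]]].
have [[nab nac nad] [nbc nbd]] := (And3 (adj_neq ab) (adj_neq ac) (adj_neq ad),
  (adj_neq bc, adj_neq bd)).
have card3 (x y z : T) : x != y -> x != z -> y != z -> #|[set x; y; z]| = 3.
  by move=> xy xz yz; rewrite setUC cardsU1 cards2 !inE negb_or xy !(eq_sym z) xz yz.
have Na : nbrs G a = [set b; c; d].
  apply/eqP; rewrite eq_sym eqEcard card3 // -/(degree G a) G3 leqnn andbT.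
  by apply/subsetP => x; rewrite !inE => /orP[/orP[]|] /eqP ->.
have Nb : nbrs G b = [set a; c; d].
  apply/eqP; rewrite eq_sym eqEcard card3 // -/(degree G b) G3 leqnn andbT.
  by apply/subsetP => x; rewrite !inE => /orP[/orP[]|] /eqP ->; rewrite // adj_sym.
pose K := [set a; b; c; d].
have K4 : #|K| = 4.
  rewrite /K setUC cardsU1 card3 // !inE !negb_or.
  by rewrite !(eq_sym d) nad nbd cd.
have outc x : x \notin K -> G c x.
  move=> xK; have := xK; rewrite !inE !negb_or => /andP[/andP[/andP[xa xb] xc] xd].
  have : nbrs G x \subset ~: [set a; b; x].
    apply/subsetP => y; rewrite !inE => xy; rewrite !negb_or eq_sym [_ == x]eq_sym.
    rewrite (adj_neq xy) andbT; apply/andP; split; apply: contraTneq xy.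
      move=> <-; rewrite adj_sym; have /setP/(_ x) := Na.
      by rewrite !inE => ->; rewrite (negPf xb) (negPf xc) (negPf xd).
    move=> ->; rewrite adj_sym; have /setP/(_ x) := Nb.
    by rewrite !inE => ->; rewrite (negPf xa) (negPf xc) (negPf xd).
  move=> sub; have /eqP/setP/(_ c) : nbrs G x == ~: [set a; b; x].
    rewrite eqEcard sub -/(degree G x) G3 cardsCs setCK T6 card3 //.
      by rewrite eq_sym.
    by rewrite eq_sym.
  by rewrite !inE adj_sym !(eq_sym c) (negPf nac) (negPf nbc) (negPf xc).
have : [set a; b] :|: ~: K \subset nbrs G c.
  apply/subsetP => x /setUP[/set2P[] ->|]; try by rewrite inE adj_sym.
  by rewrite in_setC => /outc cx; rewrite inE.
move/subset_leq_card; rewrite -/(degree G c) G3.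
have dis : [disjoint [set a; b] & ~: K].
  by rewrite disjoints_subset setCK; apply/subsetP => x; rewrite !inE => ->.
rewrite cardsU (disjoint_setI0 dis) cards0 subn0 cards2 nab.
by rewrite cardsCs setCK T6 K4.
Qed.

Section Windmill.
Variable n : nat.

(** The centre is 0 and the triangles are {0, 2k - 1, 2k}: for positive integers
    [uphalf] takes the same value exactly on the pair 2k - 1, 2k.  When n is even,
    n - 1 is left without a partner. *)
Definition windmill_rel : rel 'I_n := [rel x y : 'I_n | (x != y) &&
  [|| x == 0 :> nat, y == 0 :> nat | uphalf x == uphalf y]].

Fact windmill_sym : symmetric windmill_rel.
Proof.
move=> x y; rewrite /windmill_rel /= eq_sym orbCA; congr (_ && [|| _, _ | _]).
exact: eq_sym.
Qed.

Fact windmill_irrefl : irreflexive windmill_rel.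
Proof. by move=> x; rewrite /windmill_rel /= eqxx. Qed.

Definition windmill : sgraph 'I_n := SGraph windmill_sym windmill_irrefl.

Lemma windmill_degree_le (x : 'I_n) : x != 0 :> nat -> degree windmill x <= 2.
Proof.
move=> x0; rewrite leqNgt; apply/negP => /card_gt2P[a [b [c [[]]]]].
rewrite !inE /= /windmill_rel /= -!val_eqE /= (negPf x0) /=.
move=> /andP[xa /orP ha] /andP[xb /orP hb] /andP[xc /orP hc] [ab bc ca].
move: x0 xa xb xc ab bc ca ha hb hc; clear; rewrite !uphalfE.
by move: (nat_of_ord x) (nat_of_ord a) (nat_of_ord b) (nat_of_ord c) => {x a b c} x a b c; lia.
Qed.

End Windmill.

Lemma windmill_degree_ge m (x : 'I_m.+2) :
  (if x == 0 :> nat then m.+1 else if ~~ odd m && (x == m.+1 :> nat) then 1 else 2)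
  <= degree (windmill m.+2) x.
Proof.
case: eqP => [x0|/eqP x0].
  apply: (@leq_trans #|[set~ x]|); first by rewrite cardsC1 card_ord.
  apply/subset_leq_card/subsetP => y; rewrite !inE => yx.
  by rewrite /= /windmill_rel /= eq_sym yx x0.
have x_0 : windmill m.+2 x ord0 by rewrite /= /windmill_rel /= -val_eqE /= x0 orbT.
case: ifP => [_|/negP last].
  by apply/card_gt0P; exists ord0; rewrite inE.
pose p := if odd x then x.+1 else x.-1.
have p_lt : p < m.+2.
  move: x0 last (ltn_ord x); rewrite /p; clear; move: (nat_of_ord x) => {x} x.
  by case: ifP; lia.
apply/card_gt1P; exists ord0, (Ordinal p_lt); split; rewrite ?inE //.
  rewrite /= /windmill_rel /= -!val_eqE /= /p !uphalfE; move: x0; clear.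
  by move: (nat_of_ord x) => {x} x; case: ifP; lia.
by rewrite -val_eqE /= /p; move: x0; clear; move: (nat_of_ord x) => {x} x; case: ifP; lia.
Qed.

Lemma windmill_degree_sum m :
  (if odd m then 3 * m + 3 else 3 * m + 2) <= degree_sum (windmill m.+2).
Proof.
rewrite /degree_sum; apply: leq_trans; last by apply: leq_sum => x _; exact: windmill_degree_ge.
rewrite big_ord_recl big_ord_recr /= eqxx andbT.
rewrite (eq_bigr (fun=> 2)) => [|i _].
  by rewrite sum_nat_const card_ord; case: (odd m) => /=; lia.
rewrite /= /bump /= add1n ifF //; apply/negP => /andP[_ /eqP].
by move: (ltn_ord i); clear; lia.
Qed.

Lemma windmill_diamond_free n (G : sgraph 'I_n) :
  degree G =1 degree (windmill n) -> ~ diamond G.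
Proof.
move=> D /diamond_hubs[a [b [ab]]]; rewrite !D => da db.
have zero (x : 'I_n) : 2 < degree (windmill n) x -> x = 0 :> nat.
  by move=> d3; apply/eqP; apply: contraLR d3; rewrite -leqNgt; exact: windmill_degree_le.
by case/eqP: ab; apply: val_inj; rewrite /= !zero.
Qed.

Definition parity_rel : rel 'I_6 := [rel x y : 'I_6 | odd x != odd y].

Fact parity_sym : symmetric parity_rel.
Proof. by move=> x y; rewrite /parity_rel /= eq_sym. Qed.

Fact parity_irrefl : irreflexive parity_rel.
Proof. by move=> x; rewrite /parity_rel /= eqxx. Qed.

Definition K33 : sgraph 'I_6 := SGraph parity_sym parity_irrefl.

Lemma degree_K33 x : degree K33 x = 3.
Proof.
rewrite degreeE !big_ord_recr big_ord0 /= /parity_rel /=.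
by case: (odd x).
Qed.

(** * Degree sequences *)

Lemma realization_degree_sum n (S : n.-tuple nat) (G : sgraph 'I_n) :
  realization S G -> degree_sum G = seq_sum S.
Proof. by move=> r; apply: eq_bigr => i _; rewrite r. Qed.

Lemma dense_potentially n (S : n.-tuple nat) : 0 < n -> graphical S ->
  threshold n <= seq_sum S -> n <> 6 \/ (exists i, tnth S i != 3) ->
  potentially K4_minus_e S.
Proof.
move=> n0 [G r] thr ex.
have sT : supported G [set: 'I_n] by move=> x; rewrite inE.
have cT : #|[set: 'I_n]| = n by rewrite cardsT card_ord.
have [||G' [D dia]] := threshold_forces_diamond n0 cT sT.
- by rewrite (realization_degree_sum r).
- case=> n6 all3; case: ex => [//|[i]].
  by rewrite -r all3 // inE.
by exists G'; split; [move=> i; rewrite D r | exact/contains_diamond].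
Qed.

(** As k and m are even, k < m gives k <= m - 2, so that the degree sequence of G
    has sum at least k and refutes the bound k. *)
Lemma sigma_lower_bound n (G : sgraph 'I_n) m :
  (forall G', degree G' =1 degree G -> ~ diamond G') ->
  ~~ odd m -> m <= degree_sum G + 2 ->
  forall k, ~~ odd k -> sigma_bound K4_minus_e n k -> m <= k.
Proof.
move=> free modd mG k kodd bound; rewrite leqNgt; apply/negP => km.
pose S := [tuple degree G i | i < n].
have r : realization S G by move=> i; rewrite tnth_mktuple.
case: (bound S).
- by exists G.
- rewrite -(realization_degree_sum r); move: modd mG kodd km; clear; lia.
move=> G' [r' /contains_diamond]; apply: free => i.
by rewrite r' tnth_mktuple.
Qed.

Theorem theorem1 :
  (forall n : nat, n = 4 \/ n = 5 \/ 7 <= n ->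
     is_sigma K4_minus_e n (if odd n then 3 * n - 1 else 3 * n - 2)) /\
  (forall S : 6.-tuple nat, graphical S -> 16 <= seq_sum S ->
     potentially K4_minus_e S \/ S = [:: 3; 3; 3; 3; 3; 3] :> seq nat) /\
  is_sigma K4_minus_e 6 20.
Proof.
have six (S : 6.-tuple nat) : graphical S -> 16 <= seq_sum S ->
    potentially K4_minus_e S \/ S = [:: 3; 3; 3; 3; 3; 3] :> seq nat.
  move=> gS sS; case: (boolP [exists i, tnth S i != 3]) => [/existsP ex|none].
    by left; apply: dense_potentially => //; right.
  right; rewrite -[RHS]/(tval [tuple 3; 3; 3; 3; 3; 3]); congr tval.
  apply: eq_from_tnth => i.
  have -> : tnth S i = 3.
    by apply/eqP; apply: contraNT none => ?; apply/existsP; exists i.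
  by case: i => [[|[|[|[|[|[|]]]]]]].
split; last first.
  split=> //; split=> //.
    move=> S gS s20; have [//|S3] := six S gS (@leq_trans 20 16 _ isT s20).
    move: s20; rewrite /seq_sum.
    rewrite (eq_bigr (fun=> 3)) ?sum_nat_const ?card_ord // => i _.
    by rewrite (tnth_nth 0) S3; case: i => [[|[|[|[|[|[|]]]]]]].
  apply: (@sigma_lower_bound 6 K33) => //.
    move=> G D; apply: cubic6_diamond_free; rewrite ?card_ord // => x.
    by rewrite D degree_K33.
  by rewrite /degree_sum (eq_bigr _ (fun x _ => degree_K33 x)) sum_nat_const card_ord.
move=> n hn; set m := if odd n then _ else _.
have [n4 n6] : 4 <= n /\ n <> 6 by clear m; lia.
have modd : ~~ odd m by rewrite /m; clear -n4; case: ifP; lia.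
split=> //.
  by move=> S gS mS; apply: dense_potentially => //; [clear -n4; lia | left].
apply: (@sigma_lower_bound n (windmill n)) => //.
  exact: windmill_diamond_free.
rewrite /m; clear -n4; case: n n4 => [|[|k]] // _.
have := windmill_degree_sum k; rewrite /= negbK.
by case: (odd k); lia.
Qed.
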